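(* Let $c=v=2$, let $W_\infty\in\mathcal W_2$ satisfy $\int_0^1W_\infty(x,y)\,dy=1$ for Lebesgue-a.e. $x$ and $W_\infty>0$ Lebesgue-a.e., let $\mu(\{1\})=p$, $\mu(\{2\})=1-p$ with $p\in(0,1)$, and let $\boldsymbol{\alpha}=(\alpha_1,\alpha_2)$ with $\alpha_1\ge0$, $\alpha_2=0$. (i) If $p\ge\frac1{1+e^2}$, then for $y\in[p^2,1)$, $$I_{W_\infty,(1,0)}(y)=\sqrt y\log\Big(\frac{\sqrt y}p\Big)+(1-\sqrt y)\log\Big(\frac{1-\sqrt y}{1-p}\Big).\qquad(\ast)$$ (ii) Suppose $p<\frac1{1+e^2}$, and let $\eta>1/2$ be the unique value satisfying $2\eta-1=\tanh\big(\tfrac12\log\tfrac{1-p}p\,(2\eta-1)\big)$. (a) For $y\in[p^2,(1-\eta)^2)\cup(\eta^2,1)$, $I_{W_\infty,(1,0)}(y)$ is given by formula $(\ast)$. (b) There exist $y_\infty\in\big[(1-\eta)^2,\eta^2\big]$ and $W\in\mathcal W_2$ satisfying $W>0$ Lebesgue-a.e. and $\int_0^1W(x,y)\,dy=1$ for Lebesgue-a.e. $x$, such that all optimizers of $$\inf_{\boldsymbol f=(f,1-f)\in\mathcal F_2:\ G_{W,\mathbf 1_1}(\boldsymbol f)=y_\infty}\left\{\int_0^1 f(u)\log\frac{f(u)}p+(1-f(u))\log\frac{1-f(u)}{1-p}\,du\right\}$$ are nonconstant functions.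
   Context: $\mathcal W_2$ is the space of symmetric real-valued functions in $L^1([0,1]^2)$. $\mathcal F_2$ is the set of measurable $\boldsymbol f=(f_1,f_2):[0,1]\to[0,1]^2$ with $f_1(x)+f_2(x)=1$ for all $x$ (modulo a.e. equality). For $W\in\mathcal W_2$, $G_{W,\mathbf 1_r}(\boldsymbol f):=\int_{[0,1]^2}W(x_1,x_2)f_r(x_1)f_r(x_2)\,dx_1dx_2$. For $(a_1,a_2)\in\mathbb R^2$, $$I_{W_\infty,(a_1,a_2)}(t):=\inf_{\boldsymbol f\in\mathcal F_2:\ a_1G_{W_\infty,\mathbf 1_1}(\boldsymbol f)+a_2G_{W_\infty,\mathbf 1_2}(\boldsymbol f)=t}\left\{\int_0^1\sum_{r=1}^2 f_r(u)\log f_r(u)\,du-\sum_{r=1}^2h_r\int_0^1f_r(u)\,du\right\}+\log(e^{h_1}+e^{h_2}),$$ where $\boldsymbol h\in\mathbb R^2$ is such that $\mu(\{r\})=e^{h_r}/(e^{h_1}+e^{h_2})$, $r=1,2$. ''Nonconstant'' means not equal a.e. to a constant. Conventions: $0\log0=0$, $\inf\emptyset=+\infty$. *)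

(* Defs.v *)
From mathcomp Require Import all_boot all_order all_algebra.
From mathcomp Require Import all_classical all_reals all_analysis.

Set Implicit Arguments.
Unset Strict Implicit.
Unset Printing Implicit Defensive.

Import Order.TTheory GRing.Theory Num.Theory.
Import numFieldNormedType.Exports.
Local Open Scope classical_set_scope.
Local Open Scope ring_scope.

(* Functions on [0,1] and [0,1]^2 are total functions on R and R * R of which  *)
(* only the values on the unit interval and the unit square matter. The        *)
(* colours 1 and 2 are the ordinals 0 and 1 of 'I_2.                           *)

Definition unit_interval {R : realType} : set R := `[0, 1].

Definition unit_square {R : realType} : set (R * R) :=
  unit_interval `*` unit_interval.

Local Notation lebesgue2 R :=
  (@lebesgue_measure R \x @lebesgue_measure R)%E.

(* W_2 consists of classes modulo a.e. equality, hence symmetry holds a.e. *)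
Definition kernel2 (R : realType) (W : R * R -> R) : Prop :=
  (lebesgue2 R).-integrable unit_square (EFin \o W) /\
  {ae lebesgue2 R, forall z, unit_square z -> W z = W (z.2, z.1)}.

Definition ae_positive (R : realType) (W : R * R -> R) : Prop :=
  {ae lebesgue2 R, forall z, unit_square z -> 0 < W z}.

Definition unit_degree (R : realType) (W : R * R -> R) : Prop :=
  {ae @lebesgue_measure R, forall x, unit_interval x ->
    \int[lebesgue_measure]_(y in unit_interval) W (x, y) = 1}.

Definition F2 (R : realType) (f : 'I_2 -> R -> R) : Prop :=
  [/\ forall r, measurable_fun unit_interval (f r),
      forall r x, unit_interval x -> 0 <= f r x <= 1
    & forall x, unit_interval x -> f 0 x + f 1 x = 1].

Definition G (R : realType) (W : R * R -> R) (r : 'I_2) (f : 'I_2 -> R -> R)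
    : R :=
  \int[lebesgue2 R]_(z in unit_square) (W z * f r z.1 * f r z.2).

(* No special case is needed for 0 log 0, since ln 0 = 0. *)
Definition free_energy (R : realType) (h : 'I_2 -> R) (f : 'I_2 -> R -> R)
    : R :=
  \int[lebesgue_measure]_(u in unit_interval) (\sum_(r < 2) f r u * ln (f r u))
  - \sum_(r < 2) h r * \int[lebesgue_measure]_(u in unit_interval) f r u.

Definition rate_function (R : realType) (W : R * R -> R) (h : 'I_2 -> R)
    (a : R * R) (t : R) : \bar R :=
  (ereal_inf [set (free_energy h f)%:E | f in
     [set f | F2 f /\ (a.1 * G W 0 f + a.2 * G W 1 f = t)%R]]
   + (ln (expR (h 0) + expR (h 1)))%:E)%E.

Definition two_coloring (R : realType) (f : R -> R) : 'I_2 -> R -> R :=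
  fun r x => if r == 0 then f x else 1 - f x.

Definition relative_entropy (R : realType) (p : R) (f : R -> R) : R :=
  \int[lebesgue_measure]_(u in unit_interval)
    (f u * ln (f u / p) + (1 - f u) * ln ((1 - f u) / (1 - p))).

Definition feasible (R : realType) (W : R * R -> R) (y : R) (f : R -> R)
    : Prop :=
  F2 (two_coloring f) /\ G W 0 (two_coloring f) = y.

Definition optimizer (R : realType) (W : R * R -> R) (p y : R) (f : R -> R)
    : Prop :=
  feasible W y f /\
  forall g, feasible W y g -> relative_entropy p f <= relative_entropy p g.

Definition nonconstant (R : realType) (f : R -> R) : Prop :=
  ~ exists c, {ae @lebesgue_measure R, forall x, unit_interval x -> f x = c}.

Definition tanh (R : realType) (x : R) : R :=
  (expR x - expR (- x)) / (expR x + expR (- x)).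

Definition constant_rate (R : realType) (p y : R) : R :=
  Num.sqrt y * ln (Num.sqrt y / p)
  + (1 - Num.sqrt y) * ln ((1 - Num.sqrt y) / (1 - p)).

Definition eta_equation (R : realType) (p eta : R) : Prop :=
  2^-1 < eta /\
  2 * eta - 1 = tanh (2^-1 * ln ((1 - p) / p) * (2 * eta - 1)).

(* Main.v *)
(* Write [a] for the square root of [y]. Since the kernel has unit degrees,
   [2 f(x) f(y) <= f(x)^2 + f(y)^2] gives [G f <= \int f^2], so a function with
   [G f = y] has [\int f^2 >= a^2]. If the relative entropy, as a function of
   [s = x^2], lies above its tangent at [a^2], whose slope is nonnegative because
   [a >= p], integrating the tangent inequality shows that the constant [a] is
   optimal. With [L = ln ((1 - p) / p)], the relative entropy is convex in [s]
   exactly where [(1 - x)^-1 - logit x >= L], which is everywhere if [L <= 2].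
   If [L > 2], the relative entropy minus [L x^2] is symmetric about [1/2] and
   minimal exactly at [eta] and [1 - eta], so that a common tangent touches the
   graph at these two points, and the tangents at points outside
   [[1 - eta, eta]] still lie below the graph.

   For (b), let [s = 1] on the left half of the interval and [s = -1] on the
   right half. The kernel [1 + kappa s(x) s(y)] and the function
   [1/2 + (eta - 1/2) s], with values [eta] and [1 - eta], give
   [y = 1/4 + kappa (eta - 1/2)^2]; for [kappa] close to [1] this function beats
   the constant [a], which by the constraint is the only constant candidate. *)

Require Import Defs.
From mathcomp Require Import all_boot all_order all_algebra.
From mathcomp Require Import all_classical all_reals all_analysis.
From mathcomp Require Import measurable_realfun ring lra.

Set Implicit Arguments.
Unset Strict Implicit.
Unset Printing Implicit Defensive.

Import Order.TTheory GRing.Theory Num.Theory.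
Import numFieldNormedType.Exports.
Local Open Scope classical_set_scope.
Local Open Scope ring_scope.

(** * Monotonicity of the log-odds and related functions *)

Section calculus.
Context {R : realType}.
Implicit Types (p x a b eta lambda : R) (f df : R -> R).

Lemma mean_value f df a b : a < b ->
  (forall x, a <= x <= b -> is_derive x 1 f (df x)) ->
  exists2 c, a < c < b & f b - f a = df c * (b - a).
Proof.
move=> ab fdf.
have [||c] := @MVT R f df a b ab.
- by move=> x; rewrite in_itv/= => /andP[ax xb]; apply: fdf; rewrite !ltW.
- apply: derivable_within_continuous => x; rewrite in_itv/= => xab.
  by have [] := fdf x xab.
by rewrite in_itv/= => cab ->; exists c.
Qed.

Lemma derive_ge0_le f df a b : a <= b ->
  (forall x, a <= x <= b -> is_derive x 1 f (df x)) ->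
  (forall x, a < x < b -> 0 <= df x) -> f a <= f b.
Proof.
rewrite le_eqVlt => /predU1P[->//|ab] fdf df0.
have [c cab] := @mean_value f df a b ab fdf.
by rewrite -subr_ge0 => ->; rewrite mulr_ge0 ?df0// subr_ge0 ltW.
Qed.

Lemma derive_gt0_lt f df a b : a < b ->
  (forall x, a <= x <= b -> is_derive x 1 f (df x)) ->
  (forall x, a < x < b -> 0 < df x) -> f a < f b.
Proof.
move=> ab fdf df0; have [c cab] := @mean_value f df a b ab fdf.
by rewrite -subr_gt0 => ->; rewrite mulr_gt0 ?df0// subr_gt0.
Qed.

Lemma derive_le0_ge f df a b : a <= b ->
  (forall x, a <= x <= b -> is_derive x 1 f (df x)) ->
  (forall x, a < x < b -> df x <= 0) -> f b <= f a.
Proof.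
move=> ab fdf df0; rewrite -lerN2.
apply: (@derive_ge0_le (fun x => - f x) (fun x => - df x)) => // x xab.
  exact: is_deriveN (fdf x xab).
by rewrite oppr_ge0 df0.
Qed.

Definition logit x := ln x - ln (1 - x).

Lemma logitC x : logit (1 - x) = - logit x.
Proof. by rewrite /logit subKr opprB. Qed.

Lemma logit_half : logit 2^-1 = 0.
Proof. by rewrite /logit [1 - _](_ : _ = 2^-1) ?subrr//; field. Qed.

Lemma is_derive_1B x : is_derive x 1 (fun y : R => 1 - y) (- 1).
Proof. by rewrite -sub0r; exact: is_deriveB. Qed.

Lemma is_derive_ln1B x : x < 1 ->
  is_derive x 1 (fun y => ln (1 - y)) (- (1 - x)^-1).
Proof.
move=> x1; have x0 : 0 < 1 - x by rewrite subr_gt0.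
have := @is_derive1_comp R (@ln R) (fun y => 1 - y) x _ _
  (is_derive1_ln x0) (is_derive_1B x).
by rewrite mulrN1.
Qed.

Lemma is_derive_logit x : 0 < x < 1 ->
  is_derive x 1 logit (x^-1 + (1 - x)^-1).
Proof.
move=> /andP[x0 x1].
have := is_deriveB (is_derive1_ln x0) (is_derive_ln1B x1).
by rewrite opprK.
Qed.

Lemma is_derive_inv x : 0 < x -> is_derive x 1 (fun y => y^-1) (- x ^- 2).
Proof.
by move=> /lt0r_neq0 x0; have := is_deriveV x0 (is_derive_id x 1); rewrite /GRing.scale/= mulr1.
Qed.

Lemma is_derive_inv1B x : x < 1 ->
  is_derive x 1 (fun y => (1 - y)^-1) ((1 - x) ^- 2).
Proof.
rewrite -subr_gt0 => /lt0r_neq0 x1.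
have := @is_deriveV _ (fun y => 1 - y) x _ 1 x1 (is_derive_1B x).
by rewrite /GRing.scale/= mulrN1 opprK.
Qed.

(** The difference of the two sides vanishes at 1/2, and its derivative is a perfect square because
    [y^-1 + (1 - y)^-1 = y^-1 * (1 - y)^-1]. *)
Lemma logit_lt x : 2^-1 < x < 1 -> 2 * logit x < (1 - x)^-1 - x^-1.
Proof.
move=> /andP[x2 x1].
pose A y := (1 - y)^-1 - y^-1 - 2 * logit y.
suff : A 2^-1 < A x.
  rewrite /A logit_half [1 - 2^-1](_ : _ = 2^-1); last by field.
  by rewrite subrr mulr0 subr0 subr_gt0.
apply: (@derive_gt0_lt A (fun y => ((1 - y)^-1 - y^-1) ^+ 2)) => // y yx.
- have [y0 y1] : 0 < y /\ y < 1 by split; lra.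
  have y01 : 0 < y < 1 by rewrite y0.
  have := is_deriveB (is_deriveB (is_derive_inv1B y1)
    (is_derive_inv y0)) (is_deriveZ 2 (is_derive_logit y01)).
  move=> d; apply: (is_derive_eq d); rewrite /GRing.scale/=; field.
  by rewrite gt_eqF// subr_eq0 eq_sym lt_eqF.
- rewrite exprn_gt0// subr_gt0 ltf_pV2 ?posrE; lra.
Qed.

(** Up to a factor 2 the quotient is the slope of the chord of [logit] from 1/2; [logit_lt] is the
    positivity of the numerator of its derivative. This yields both the uniqueness of [eta] and the
    shape of [tilted L L]. *)
Lemma logit_secant_lt x y : 2^-1 < x -> x < y -> y < 1 ->
  logit x / (2 * x - 1) < logit y / (2 * y - 1).
Proof.
move=> x2 xy y1.
apply: (@derive_gt0_lt (fun z => logit z / (2 * z - 1))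
  (fun z => ((1 - z)^-1 - z^-1 - 2 * logit z) / (2 * z - 1) ^+ 2)) => // z zxy.
- have z01 : 0 < z < 1 by lra.
  have z2 : 2 * z - 1 != 0 by rewrite gt_eqF//; lra.
  have d2 : is_derive z 1 (fun z : R => 2 * z - 1) 2.
    apply: (is_derive_eq (is_deriveB (is_deriveZ 2 (is_derive_id z (1 : R)))
      (is_derive_cst (1 : R) z 1))).
    by rewrite subr0 /GRing.scale/= mulr1.
  have := is_deriveM (is_derive_logit z01)
    (@is_deriveV _ (fun z => 2 * z - 1) z _ 1 z2 d2).
  move=> d; apply: (is_derive_eq d); rewrite /GRing.scale/=.
  by field; rewrite z2 !gt_eqF//; lra.
- rewrite divr_gt0//; last by rewrite exprn_gt0//; lra.
  by rewrite subr_gt0 logit_lt//; lra.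
Qed.

(* Half of [(logit x + L) / x] is the slope, with respect to [x ^+ 2], of the
   relative entropy. *)
Lemma is_derive_logit_slope L x : 0 < x < 1 ->
  is_derive x 1 (fun y => (logit y + L) / y)
    (((1 - x)^-1 - logit x - L) / x ^+ 2).
Proof.
move=> x01; have x0 : 0 < x by lra.
have dL : is_derive x 1 (fun y => logit y + L) (x^-1 + (1 - x)^-1 + 0).
  by apply: is_deriveD; exact: is_derive_logit.
have := is_deriveM dL (is_derive_inv x0).
move=> d; apply: (is_derive_eq d); rewrite /GRing.scale/=.
by field; rewrite !gt_eqF//; lra.
Qed.

(** By [is_derive_logit_slope], the relative entropy is convex in the square where this function is
    at least [L]. Its derivative changes sign only at 1/2. *)
Lemma is_derive_curvature x : 0 < x < 1 ->
  is_derive x 1 (fun y => (1 - y)^-1 - logit y)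
   ((2 * x - 1) / (x * (1 - x) ^+ 2)).
Proof.
move=> /[dup] x01 /andP[x0 x1].
have := is_deriveB (is_derive_inv1B x1) (is_derive_logit x01).
by move=> d; apply: (is_derive_eq d); field; rewrite !gt_eqF//; lra.
Qed.

Lemma curvature_nincr x y : 0 < x -> x <= y -> y <= 2^-1 ->
  (1 - y)^-1 - logit y <= (1 - x)^-1 - logit x.
Proof.
move=> x0 xy y2; apply: (@derive_le0_ge (fun y => (1 - y)^-1 - logit y) _ x y xy).
  by move=> z zxy; apply: is_derive_curvature; lra.
move=> z zxy /=; rewrite mulr_le0_ge0//; first lra.
by rewrite invr_ge0 mulr_ge0 ?sqr_ge0//; lra.
Qed.

Lemma curvature_ndecr x y : 2^-1 <= x -> x <= y -> y < 1 ->
  (1 - x)^-1 - logit x <= (1 - y)^-1 - logit y.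
Proof.
move=> x0 xy y2; apply: (@derive_ge0_le (fun y => (1 - y)^-1 - logit y) _ x y xy).
  by move=> z zxy; apply: is_derive_curvature; lra.
move=> z zxy /=; rewrite mulr_ge0//; first lra.
by rewrite invr_ge0 mulr_ge0 ?sqr_ge0//; lra.
Qed.

(** The minimum is attained at 1/2. This is the origin of the threshold [L <= 2], below which the
    relative entropy is convex in the square everywhere. *)
Lemma curvature_ge2 x : 0 < x < 1 -> 2 <= (1 - x)^-1 - logit x.
Proof.
move=> x01; have <- : (1 - 2^-1)^-1 - logit 2^-1 = 2.
  by rewrite logit_half subr0; field.
by have [x2|x2] := leP x 2^-1; [apply: curvature_nincr|apply: curvature_ndecr]; lra.
Qed.

Lemma logit_slope_ndecr L x y : 0 < x -> x <= y -> y < 1 ->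
  (forall z, x < z < y -> L <= (1 - z)^-1 - logit z) ->
  (logit x + L) / x <= (logit y + L) / y.
Proof.
move=> x0 xy y1 Lm; apply: (@derive_ge0_le (fun y => (logit y + L) / y) _ x y xy).
  by move=> z zxy; apply: is_derive_logit_slope; lra.
by move=> z zxy /=; rewrite divr_ge0 ?sqr_ge0// subr_ge0 Lm.
Qed.

End calculus.

(** * Tangents to the relative entropy as a function of the square *)

Section divergence.
Context {R : realType}.
Implicit Types (p x a b eta lambda : R).

Definition bernoulli_divergence p x :=
  x * ln (x / p) + (1 - x) * ln ((1 - x) / (1 - p)).

Definition neg_entropy x : R := x * ln x + (1 - x) * ln (1 - x).

(** For [L = - logit p] this is the relative entropy minus [lambda * x ^+ 2], up to an additive
    constant. A line of slope [lambda] in the square supports the relative entropy at [a] exactly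
    when [a] minimizes it. *)
Definition tilted (L lambda x : R) := neg_entropy x + L * x - lambda * x ^+ 2.

Lemma xln_div p x : 0 < p -> 0 <= x -> x * ln (x / p) = x * ln x - x * ln p.
Proof.
move=> p0; rewrite le_eqVlt => /predU1P[<-|x0]; first by rewrite !mul0r subr0.
by rewrite ln_div ?posrE// mulrBr.
Qed.

Lemma bernoulli_divergenceE p x lambda : 0 < p < 1 -> 0 <= x <= 1 ->
  bernoulli_divergence p x =
  tilted (- logit p) lambda x + lambda * x ^+ 2 - ln (1 - p).
Proof.
move=> p01 x01; rewrite /bernoulli_divergence !xln_div; [|lra..].
by rewrite /tilted /neg_entropy /logit; ring.
Qed.

Lemma neg_entropyC x : neg_entropy (1 - x) = neg_entropy x.
Proof. by rewrite /neg_entropy subKr addrC. Qed.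

Lemma xln_le0 x : 0 <= x <= 1 -> x * ln x <= 0.
Proof. by move=> /andP[x0 x1]; rewrite mulr_ge0_le0// ln_le0. Qed.

Lemma neg_entropy_le0 x : 0 <= x <= 1 -> neg_entropy x <= 0.
Proof. by move=> x01; have := @xln_le0 x; have := @xln_le0 (1 - x); rewrite /neg_entropy; lra. Qed.

(** This is the limit at 0, obtained from one explicit small [x]. *)
Lemma quadratic_ge_at0 (c alpha beta gamma : R) :
  (forall x, 0 < x < 1 -> c <= alpha + beta * x + gamma * x ^+ 2) ->
  c <= alpha.
Proof.
move=> h; rewrite leNgt; apply/negP => ac.
(* For [x < 1] the nonconstant terms are at most [(|beta| + |gamma|) * x], strictly below
   [M * x]. *)
pose M := `|beta| + `|gamma| + 1.
have M0 : 0 < M by rewrite /M ltr_wpDl// addr_ge0.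
pose x := Num.min 2^-1 ((c - alpha) / M).
have x0 : 0 < x by rewrite lt_min invr_gt0 ltr0n/= divr_gt0// subr_gt0.
have x1 : x < 1 by rewrite gt_min; apply/orP; left; lra.
have xM : x * M <= c - alpha by rewrite -ler_pdivlMr// ge_min lexx orbT.
have := h x; rewrite x0 x1 => /(_ isT).
have : beta * x <= `|beta| * x by rewrite ler_pM2r// ler_norm.
have : gamma * x ^+ 2 <= `|gamma| * x.
  rewrite (le_trans (ler_norm _))// normrM ler_wpM2l// ger0_norm ?sqr_ge0//.
  by rewrite expr2 ler_piMr// ltW.
move: xM; rewrite /M; nra.
Qed.

(* Negative entropy vanishes at the endpoints and is nonpositive inside, so
   no continuity argument is needed. *)
Lemma tilted_ge_closed L lambda c :
  (forall x, 0 < x < 1 -> c <= tilted L lambda x) ->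
  forall x, 0 <= x <= 1 -> c <= tilted L lambda x.
Proof.
move=> h x /andP[]; rewrite le_eqVlt => /predU1P[<- _|x0].
  apply: (@quadratic_ge_at0 _ _ L (- lambda)) => y y01.
  have := h y y01; have := @neg_entropy_le0 y.
  by rewrite /tilted {3}/neg_entropy subr0 ln1; lra.
rewrite le_eqVlt => /predU1P[->|x1]; last by apply: h; rewrite x0.
(* The coefficients come from expanding [L * (1 - y) - lambda * (1 - y) ^+ 2] in powers of [y]. *)
apply: (@quadratic_ge_at0 _ _ (- L + lambda *+ 2) (- lambda)) => y y01.
have := h (1 - y); have := @neg_entropy_le0 y.
rewrite /tilted neg_entropyC {3}/neg_entropy subrr ln1 => h1 /(_ _)/le_trans -> //; nra.
Qed.

Lemma is_derive_neg_entropy x : 0 < x < 1 ->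
  is_derive x 1 neg_entropy (logit x).
Proof.
move=> /andP[x0 x1].
have d := is_deriveD (is_deriveM (is_derive_id x (1 : R)) (is_derive1_ln x0))
  (is_deriveM (is_derive_1B x) (is_derive_ln1B x1)).
apply: (is_derive_eq d); rewrite /GRing.scale/= /logit.
by field; rewrite !gt_eqF//; lra.
Qed.

Lemma is_derive_tilted L lambda x : 0 < x < 1 ->
  is_derive x 1 (tilted L lambda) (logit x + L - 2 * lambda * x).
Proof.
move=> x01.
have d := is_deriveB (is_deriveD (is_derive_neg_entropy x01)
  (is_deriveZ L (is_derive_id x (1 : R))))
  (is_deriveZ lambda (is_deriveX 2 (is_derive_id x (1 : R)))).
apply: (is_derive_eq d); rewrite /GRing.scale/=; ring.
Qed.

(** The value of [lambda] makes the derivative vanish at [a]. At [z] the derivative is [z] times the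
    increase of the slope [(logit z + L) / z] from [a] to [z], and this slope is monotone on the
    interval. *)
Lemma tilted_min_itv L a b c x : 0 < b -> b <= a <= c -> c < 1 ->
  (forall z, b < z < c -> L <= (1 - z)^-1 - logit z) -> b <= x <= c ->
  tilted L ((logit a + L) / a / 2) a <= tilted L ((logit a + L) / a / 2) x.
Proof.
move=> b0 bac c1 Lm bxc; set lambda := _ / 2.
have dE z : 0 < z -> logit z + L - 2 * lambda * z =
    z * ((logit z + L) / z - (logit a + L) / a).
  by move=> z0; rewrite /lambda; field; rewrite !gt_eqF//; lra.
have [xa|ax] := leP x a.
- apply: (derive_le0_ge xa) => z zxa; first by apply: is_derive_tilted; lra.
  rewrite /= dE; last lra.
  rewrite mulr_ge0_le0//; first lra.
  rewrite subr_le0; apply: logit_slope_ndecr; try lra.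
  by move=> w wza; apply: Lm; lra.
- apply: (derive_ge0_le (ltW ax)) => z zxa; first by apply: is_derive_tilted; lra.
  rewrite /= dE; last lra.
  rewrite mulr_ge0//; first lra.
  rewrite subr_ge0; apply: logit_slope_ndecr; try lra.
  by move=> w wza; apply: Lm; lra.
Qed.

Lemma tilted_min_small L a x : L <= 2 -> 0 < a < 1 -> 0 < x < 1 ->
  tilted L ((logit a + L) / a / 2) a <= tilted L ((logit a + L) / a / 2) x.
Proof.
move=> L2 a01 x01.
apply: (@tilted_min_itv L a (Num.min a x) (Num.max a x) x).
- by rewrite lt_min; lra.
- by rewrite ge_min le_max lexx.
- by rewrite gt_max; lra.
- move=> z; rewrite gt_min lt_max => zax.
  by apply: le_trans L2 (curvature_ge2 _); case/andP: zax => /orP[] ? /orP[] ?; lra.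
- by rewrite ge_min le_max lexx !orbT.
Qed.

(** * The regime with minima at [eta] and [1 - eta] *)

Section eta.
Variables (L eta : R).
Hypotheses (eta_itv : 2^-1 < eta < 1) (Leta : logit eta = L * (2 * eta - 1)).

(** This is [logit_lt] at [eta], multiplied by [eta * (1 - eta)]. It expresses the convexity
    condition at [eta] and at [1 - eta] alike. *)
Lemma eta_curvature : 2 * L * eta * (1 - eta) < 1.
Proof.
have eta2 := eta_itv.
have := logit_lt eta2; rewrite Leta => h.
have {}h : 2 * (L * (2 * eta - 1)) < (2 * eta - 1) / (eta * (1 - eta)).
  by apply: (lt_le_trans h); rewrite le_eqVlt; apply/orP; left; apply/eqP; field;
    rewrite !gt_eqF//; lra.
have e0 : 0 < eta * (1 - eta) by rewrite mulr_gt0; lra.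
move: h; rewrite ltr_pdivlMr//.
rewrite [X in X < _](_ : _ = (2 * L * eta * (1 - eta)) * (2 * eta - 1)); last ring.
by rewrite gtr_pMl//; lra.
Qed.

(** With equal coefficients the polynomial part is [L * x * (1 - x)]. *)
Lemma tiltedC x : tilted L L (1 - x) = tilted L L x.
Proof. by rewrite /tilted neg_entropyC; ring. Qed.

(** The derivative is [logit z - L * (2 * z - 1)]. Its sign compares the chord slope at [z] with
    [L], which is the chord slope at [eta]. *)
Lemma tilted_decr x y : 2^-1 <= x -> x < y -> y <= eta ->
  tilted L L y < tilted L L x.
Proof.
have eta2 := eta_itv.
move=> x2 xy yeta; rewrite -ltrN2.
apply: (@derive_gt0_lt R (fun z => - tilted L L z)
  (fun z => - (logit z + L - 2 * L * z)) _ _ xy) => z zxy.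
  by apply: is_deriveN; apply: is_derive_tilted; lra.
have := @logit_secant_lt R z eta; rewrite Leta mulfK; last by rewrite gt_eqF//; lra.
by rewrite ltr_pdivrMr; [|lra]; lra.
Qed.

Lemma tilted_incr x y : eta <= x -> x <= y -> y < 1 ->
  tilted L L x <= tilted L L y.
Proof.
have eta2 := eta_itv.
move=> x2 xy yeta.
apply: (derive_ge0_le xy) => z zxy; first by apply: is_derive_tilted; lra.
have := @logit_secant_lt R eta z; rewrite Leta mulfK; last by rewrite gt_eqF//; lra.
by rewrite ltr_pdivlMr; [|lra]; lra.
Qed.

Lemma tilted_min_eta x : 0 < x < 1 -> tilted L L eta <= tilted L L x.
Proof.
have eta2 := eta_itv.
wlog x2 : x / 2^-1 <= x => [hw x01|x01].
  by have [/hw|x2] := leP 2^-1 x; [exact|rewrite -(tiltedC x) hw//; lra].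
have [xe|ex|->//] := ltgtP x eta.
  by rewrite ltW// tilted_decr//.
by rewrite tilted_incr// ?ltW//; lra.
Qed.

(** Monotonicity to the right of 1/2 reduces the claim to [z = eta], where it is [eta_curvature]. *)
Lemma curvature_ge_right z : eta <= z < 1 -> L <= (1 - z)^-1 - logit z.
Proof.
have eta2 := eta_itv.
move=> z1; apply: (@le_trans _ _ ((1 - eta)^-1 - logit eta)); last first.
  by apply: curvature_ndecr; lra.
rewrite Leta lerBrDr -(ler_pM2r (_ : 0 < 1 - eta)) ?mulVf ?gt_eqF; try lra.
by have := eta_curvature; lra.
Qed.

Lemma curvature_ge_left z : 0 < z <= 1 - eta -> L <= (1 - z)^-1 - logit z.
Proof.
have eta2 := eta_itv.
move=> z1; apply: (@le_trans _ _ ((1 - (1 - eta))^-1 - logit (1 - eta))); last first.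
  by apply: curvature_nincr; lra.
rewrite logitC Leta subKr opprK -lerBlDr -(ler_pM2r (_ : 0 < eta)) ?mulVf ?gt_eqF; try lra.
by have := eta_curvature; lra.
Qed.

(* Outside [[1 - eta, eta]] the tangent at [a] stays below the common tangent
   of slope [L] on the far side of the nearest of the points [eta], [1 - eta]. *)
Lemma tilted_min_far a x : 0 < a < 1 -> a < 1 - eta \/ eta < a -> 0 < x < 1 ->
  tilted L ((logit a + L) / a / 2) a <= tilted L ((logit a + L) / a / 2) x.
Proof.
have eta2 := eta_itv.
move=> a01 aeta x01; set lambda := _ / 2.
(* Since [tilted L lambda] is [tilted L L] minus [(lambda - L) * x ^+ 2] and [b] minimizes
   [tilted L L], a favourable sign of the last term carries the bound from [b] to [x]. *)
have far b : 0 < b < 1 -> b = eta \/ b = 1 - eta ->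
    tilted L lambda a <= tilted L lambda b ->
    (lambda - L) * (x ^+ 2 - b ^+ 2) <= 0 ->
    tilted L lambda a <= tilted L lambda x.
  move=> b01 be ab lx; apply: le_trans ab _.
  have : tilted L L b <= tilted L L x.
    by case: be => ->; rewrite ?tiltedC; exact: tilted_min_eta.
  by rewrite /tilted; move: lx; lra.
case: aeta => aeta.
- have [xe|ex] := leP x (1 - eta).
    apply: (@tilted_min_itv L a (Num.min a x) (1 - eta)).
    + by rewrite lt_min; lra.
    + by rewrite ge_min lexx /= ltW.
    + lra.
    + by move=> z; rewrite gt_min => /andP[/orP[] ? ?]; apply: curvature_ge_left; lra.
    + by rewrite ge_min lexx orbT.
  apply: (far (1 - eta)); [lra|by right| |].
    apply: (@tilted_min_itv L a a (1 - eta)); try lra.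
    by move=> z az; apply: curvature_ge_left; lra.
  rewrite mulr_le0_ge0//; last first.
    by rewrite subr_ge0 ler_pXn2r ?nnegrE//; lra.
  (* At [1 - eta], as at [eta], the slope in the square is exactly [L], so its monotonicity between
     [a] and [1 - eta] gives [lambda <= L]. *)
  rewrite subr_le0 /lambda ler_pdivrMr//.
  apply: le_trans (@logit_slope_ndecr _ L a (1 - eta) _ _ _ _) _; try lra.
    by move=> z az; apply: curvature_ge_left; lra.
  by rewrite ler_pdivrMr; [|lra]; rewrite logitC Leta; lra.
- have [xe|ex] := leP eta x.
    apply: (@tilted_min_itv L a eta (Num.max a x)).
    + lra.
    + by rewrite le_max lexx /= ltW.
    + by rewrite gt_max; lra.
    + by move=> z; rewrite lt_max => /andP[? /orP[] ?]; apply: curvature_ge_right; lra.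
    + by rewrite le_max lexx orbT xe.
  apply: (far eta); [lra|by left| |].
    apply: (@tilted_min_itv L a eta a); try lra.
    by move=> z az; apply: curvature_ge_right; lra.
  rewrite mulr_ge0_le0//; last first.
    by rewrite subr_le0 ler_pXn2r ?nnegrE//; lra.
  (* Here the slope equals [L] at [eta] and increases towards [a], so [L <= lambda]. *)
  rewrite subr_ge0 /lambda ler_pdivlMr//.
  apply: le_trans (@logit_slope_ndecr _ L eta a _ _ _ _); try lra.
    by rewrite ler_pdivlMr; [|lra]; rewrite Leta; lra.
  by move=> z az; apply: curvature_ge_right; lra.
Qed.

End eta.
End divergence.

(** * The equation for [eta] and the threshold on [p] *)

Section critical_point.
Context {R : realType}.
Implicit Types (p a eta : R).

Lemma ln_odds p : 0 < p < 1 -> ln ((1 - p) / p) = - logit p.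
Proof. by move=> p01; rewrite ln_div ?posrE; [rewrite opprB|lra|lra]. Qed.

(** With [t] the argument of [tanh], the equation says that [eta] is [expR t] divided by
    [expR t + expR (- t)], so its log-odds are [2 * t]. In particular [eta < 1]. *)
Lemma eta_equationE p eta : 0 < p < 1 ->
  eta_equation p eta <->
  2^-1 < eta < 1 /\ logit eta = - logit p * (2 * eta - 1).
Proof.
move=> p01; rewrite /eta_equation ln_odds// /tanh.
set t := _ * _ * _.
have t2 : - logit p * (2 * eta - 1) = t - (- t) by rewrite /t; field.
rewrite t2; move: (expR_gt0 t) (expR_gt0 (- t)).
set E := expR t; set E' := expR (- t) => E0 E'0.
have S0 : E + E' != 0 by rewrite gt_eqF// addr_gt0.
split=> [[eta2 eqn]|[eta2 eqn]].
- have e1 : eta = E / (E + E').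
    have -> : eta = (2 * eta - 1 + 1) / 2 by field.
    by rewrite eqn; field.
  have e2 : 1 - eta = E' / (E + E') by rewrite e1; field.
  split; first by rewrite eta2 -subr_gt0 e2 divr_gt0 ?addr_gt0.
  rewrite /logit e2 e1 !ln_div ?posrE ?addr_gt0// /E /E' !expRK; lra.
- split; first by case/andP: eta2.
  have : expR (logit eta) = expR (t - (- t)) by rewrite eqn.
  rewrite /logit !expRB !lnK ?posrE; [|lra..].
  rewrite -/E -/E' => /(congr1 (fun z => z * (1 - eta) * E')).
  rewrite /= divfK; last by rewrite gt_eqF//; lra.
  rewrite mulrAC divfK; last by rewrite gt_eqF.
  move=> h.
  by apply: (mulIf S0); rewrite divfK//; lra.
Qed.

Lemma logit_le a b : 0 < a -> a <= b -> b < 1 -> logit a <= logit b :> R.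
Proof.
by move=> a0 ab b1; rewrite /logit lerB// ler_ln ?posrE; lra.
Qed.

Lemma le_logit_threshold p : 0 < p < 1 ->
  ((1 + expR 2)^-1 <= p) = (- logit p <= 2).
Proof.
move=> p01; rewrite -ln_odds// -[RHS]ler_expR lnK ?posrE; last by rewrite divr_gt0; lra.
rewrite ler_pdivrMr; last lra.
rewrite -[LHS](ler_pM2r (_ : 0 < 1 + expR 2)); last by rewrite addr_gt0 ?expR_gt0.
rewrite mulVf; last by rewrite gt_eqF// addr_gt0 ?expR_gt0.
by apply/idP/idP; lra.
Qed.

Lemma eta_exists_unique p : 0 < p < 1 -> p < (1 + expR 2)^-1 ->
  exists! eta, eta_equation p eta.
Proof.
move=> p01; rewrite ltNge le_logit_threshold// -ltNge => L2.
set L := - logit p in L2 *.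
(* From [expR 2 > 3]; this places [2^-1 + d], chosen below, to the left of [1 - p]. *)
have p4 : p < 4^-1.
  have : (1 - p) / p > expR 2.
    by rewrite -[ltRHS]lnK ?posrE ?ltr_expR ?ln_odds// divr_gt0; lra.
  rewrite ltr_pdivlMr; last lra.
  by have := expR_gt1Dx (_ : 2 != 0 :> R); rewrite pnatr_eq0 => /(_ isT); nra.
(* The left endpoint must avoid the trivial zero 1/2. At [x = 2^-1 + d] one has [x * (1 - x) = 4^-1
   - d ^+ 2 >= 4^-1 - d = (2 * L)^-1], and then [logit_lt] makes [f x] nonpositive. Positivity of
   [d] is the condition [L > 2]. *)
pose d := 4^-1 - (2 * L)^-1.
have d0 : 0 < d by rewrite subr_gt0 ltf_pV2 ?posrE; lra.
have d4 : d < 4^-1 by rewrite gtrBl invr_gt0; lra.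
pose f x := logit x - L * (2 * x - 1).
have [|||eta] := @IVT R f (2^-1 + d) (1 - p) 0.
- lra.
- apply: derivable_within_continuous => x; rewrite in_itv/= => x01.
  have x01' : 0 < x < 1 by lra.
  have h := is_deriveB (is_derive_logit x01')
   (is_deriveZ L (is_deriveB (is_deriveZ 2 (is_derive_id x (1 : R)))
      (is_derive_cst (1 : R) x 1))).
  by case: h.
- have f0 : f (2^-1 + d) <= 0.
    have := @logit_lt R (2^-1 + d); set x := 2^-1 + d.
    have x2 : 2^-1 < x < 1 by rewrite /x; lra.
    have x0 : 0 < x * (1 - x) by rewrite mulr_gt0; lra.
    have -> : (1 - x)^-1 - x^-1 = (2 * x - 1) / (x * (1 - x)).
      by field; rewrite !gt_eqF//; lra.
    rewrite x2 ltr_pdivlMr// => /(_ isT) h.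
    have Lx : 1 <= 2 * L * (x * (1 - x)).
      apply: (@le_trans _ _ (2 * L * (2 * L)^-1)).
        by rewrite mulfV// gt_eqF//; lra.
      rewrite ler_pM2l; last lra.
      have -> : (2 * L)^-1 = 4^-1 - d by rewrite /d; ring.
      by rewrite /x; nra.
    rewrite /f subr_le0 -(ler_pM2r x0).
    apply: (@le_trans _ _ ((2 * x - 1) / 2)); first lra.
    have : 0 <= (2 * x - 1) * (2 * L * (x * (1 - x)) - 1).
      by rewrite mulr_ge0// ?subr_ge0//; lra.
    lra.
  have f1 : 0 <= f (1 - p).
    rewrite /f logitC -/L (_ : L - _ = 2 * L * p); last by ring.
    by rewrite !mulr_ge0; lra.
  by rewrite ge_min f0 le_max f1 !orbT.
rewrite in_itv/= => eta_itv /eqP; rewrite subr_eq0 => /eqP eta_eq.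
exists eta; split; first by apply/eta_equationE => //; split; [lra|].
move=> eta' /eta_equationE -/(_ p01) [eta'_itv eta'_eq].
have e2 : 2^-1 < eta < 1 by lra.
have [lt|lt|//] := ltgtP eta eta'.
- have := @logit_secant_lt R eta eta'.
  by rewrite eta_eq eta'_eq !mulfK ?ltxx; [|rewrite gt_eqF//; lra..]; lra.
- have := @logit_secant_lt R eta' eta.
  by rewrite eta_eq eta'_eq !mulfK ?ltxx; [|rewrite gt_eqF//; lra..]; lra.
Qed.

(** The supporting line is the tangent at [a]. Its slope is nonnegative because
    [logit p <= logit a]; the sign matters because the constraint only bounds the integral of the
    square from below. *)
Lemma divergence_tangent p a : 0 < p < 1 -> p <= a < 1 ->
  (1 + expR 2)^-1 <= p \/
    (exists2 eta, eta_equation p eta & a < 1 - eta \/ eta < a) ->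
  exists2 lambda, 0 <= lambda & forall x, 0 <= x <= 1 ->
    bernoulli_divergence p a + lambda * (x ^+ 2 - a ^+ 2)
      <= bernoulli_divergence p x.
Proof.
move=> p01 pa H; have a01 : 0 < a < 1 by lra.
set L := - logit p; exists ((logit a + L) / a / 2).
  rewrite divr_ge0// divr_ge0//; last lra.
  by rewrite subr_ge0 logit_le; lra.
move=> x x01; rewrite !(bernoulli_divergenceE ((logit a + L) / a / 2))//; last lra.
suff : tilted L ((logit a + L) / a / 2) a <= tilted L ((logit a + L) / a / 2) x.
  by rewrite -/L; lra.
apply: tilted_ge_closed x01 => {}x x01.
case: H => [|[eta /eta_equationE -/(_ p01)[eta2 Leta] aeta]].
  by rewrite le_logit_threshold// => L2; apply: tilted_min_small.
exact: (@tilted_min_far R L eta).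
Qed.

End critical_point.

(** * Integrals over the unit square *)

Local Notation lebesgue2 R := (@lebesgue_measure R \x @lebesgue_measure R)%E.

Section swap.
Context d1 d2 (T1 : measurableType d1) (T2 : measurableType d2) {R : realType}.
Variables (m1 : {sigma_finite_measure set T1 -> \bar R})
  (m2 : {sigma_finite_measure set T2 -> \bar R}).
Implicit Types H : T1 * T2 -> \bar R.

Lemma integrable_swap H : (m1 \x m2)%E.-integrable setT H ->
  (m2 \x m1)%E.-integrable setT (H \o unstable.swap).
Proof.
move=> iH; have mH := measurable_int _ iH.
have mHs : measurable_fun setT (H \o unstable.swap).
  by apply: measurableT_comp => //; exact: measurable_swap.
by apply/(integrable12ltyP _ _ mHs); exact/(integrable21ltyP _ _ mH).
Qed.

(** Fubini in opposite orders reduces both sides to the same iterated integral. *)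
Lemma integral_swap H : (m1 \x m2)%E.-integrable setT H ->
  (\int[m2 \x m1]_z (H \o unstable.swap) z = \int[m1 \x m2]_z H z)%E.
Proof.
move=> iH; rewrite -(integral12_prod_meas1 (integrable_swap iH)).
by rewrite -(integral21_prod_meas1 iH).
Qed.

End swap.

Section unit_square_integrals.
Context {R : realType}.
Local Notation mu := (@lebesgue_measure R).
Local Notation mu2 := (lebesgue2 R).
Implicit Types (W : R * R -> R) (g d : R -> R).

Lemma measurable_unit_interval :
  measurable (unit_interval : set (measurableTypeR R)).
Proof. exact: measurable_itv. Qed.
Local Hint Resolve measurable_unit_interval : core.

Lemma lebesgue_unit_interval : mu unit_interval = 1%E.
Proof. by rewrite lebesgue_measure_itv/= lte_fin ltr01 oppr0 adde0. Qed.

Lemma measurable_unit_square :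
  measurable (unit_square : set (measurableTypeR R * measurableTypeR R)).
Proof. exact: measurableX. Qed.
Local Hint Resolve measurable_unit_square : core.

Lemma lebesgue_unit_square : mu2 unit_square = 1%E.
Proof.
by rewrite product_measure1E//= lebesgue_unit_interval mul1e.
Qed.

Lemma integrable_unit_interval g (M : R) : measurable_fun unit_interval g ->
  (forall x, unit_interval x -> `|g x| <= M) ->
  mu.-integrable unit_interval (EFin \o g).
Proof.
move=> mg gM; apply: measurable_bounded_integrable => //.
  by rewrite [X in (X < _)%E]lebesgue_unit_interval ltry.
exists M; split; first exact: num_real.
by move=> N MN x Ix /=; rewrite (le_trans (gM x Ix))// ltW.
Qed.

Lemma integrable_unit_square W (M : R) : measurable_fun unit_square W ->
  (forall z, unit_square z -> `|W z| <= M) ->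
  mu2.-integrable unit_square (EFin \o W).
Proof.
move=> mW WM.
apply: (@measurable_bounded_integrable _ _ _ mu2 _ _ measurable_unit_square) => //.
  by rewrite [X in (X < _)%E]lebesgue_unit_square ltry.
exists M; split; first exact: num_real.
by move=> N MN z Iz /=; rewrite (le_trans (WM z Iz))// ltW.
Qed.

Lemma integrable_kernelM W (h : R * R -> R) (M : R) :
  mu2.-integrable unit_square (EFin \o W) ->
  measurable_fun unit_square h ->
  (forall z, unit_square z -> `|h z| <= M) ->
  mu2.-integrable unit_square (fun z => (W z * h z)%:E).
Proof.
move=> iW mh hM; apply: (@integrableMl _ _ _ mu2 _ measurable_unit_square _ h iW mh).
exists M; split; first exact: num_real.
by move=> N MN z Iz /=; rewrite (le_trans (hM z Iz))// ltW.
Qed.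

Lemma measurable_fun_fst g : measurable_fun unit_interval g ->
  measurable_fun unit_square (fun z : R * R => g z.1).
Proof.
move=> mg; apply: (@measurable_comp _ _ _ _ _ _ unit_interval g _ fst) => //.
  by move=> _ [z [z1 z2] <-].
exact: measurable_funTS.
Qed.

Lemma measurable_fun_snd g : measurable_fun unit_interval g ->
  measurable_fun unit_square (fun z : R * R => g z.2).
Proof.
move=> mg; apply: (@measurable_comp _ _ _ _ _ _ unit_interval g _ snd) => //.
  by move=> _ [z [z1 z2] <-].
exact: measurable_funTS.
Qed.

(** A null set times the whole line is null, by the convention that 0 times infinity is 0. *)
Lemma ae_fst (P : R -> Prop) : {ae mu, forall x, P x} ->
  {ae mu2, forall z, P z.1}.
Proof.
move=> [N [mN N0 PN]]; exists (N `*` setT); split.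
- exact: measurableX.
- by rewrite product_measure1E//= N0 mul0e.
- by move=> z /= Pz; split=> //; apply: PN.
Qed.

Lemma ae_snd (P : R -> Prop) : {ae mu, forall x, P x} ->
  {ae mu2, forall z, P z.2}.
Proof.
move=> [N [mN N0 PN]]; exists (setT `*` N); split.
- exact: measurableX.
- by rewrite product_measure1E//= N0 mule0.
- by move=> z /= Pz; split=> //; apply: PN.
Qed.

(** Fubini, integrating over the second variable first. A nonconstant degree [d] serves to evaluate
    [G] on the block kernel. *)
Lemma kernel_integral_degree W d g : mu2.-integrable unit_square (EFin \o W) ->
  {ae mu, forall x, unit_interval x ->
    \int[mu]_(y in unit_interval) W (x, y) = d x} ->
  measurable_fun unit_interval d -> measurable_fun unit_interval g ->
  (forall x, unit_interval x -> `|g x| <= 1) ->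
  (\int[mu2]_(z in unit_square) (W z * g z.1)%:E =
   \int[mu]_(x in unit_interval) (g x * d x)%:E)%E.
Proof.
move=> iW dW md mg g1.
have iWg : mu2.-integrable unit_square (fun z => (W z * g z.1)%:E).
  apply: (@integrable_kernelM W (fun z => g z.1) 1) => //; first exact: measurable_fun_fst.
  by move=> z [z1 _]; exact: g1.
(* Both integrands are extended by zero, so that Fubini is applied on the whole plane. *)
rewrite integral_mkcond [RHS]integral_mkcond.
set H := (X in (\int[mu2]_z X z)%E).
have iH : mu2.-integrable setT H.
  exact: (integrable_mkcond _ measurable_unit_square).1 iWg.
rewrite -(integral12_prod_meas1 iH).
apply: ae_eq_integral => //.
- exact: (measurable_fubini_F iH).
- by apply/(measurable_restrictT _ _).1 => //; apply/measurable_EFinP;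
    exact: measurable_funM.
have iW' : mu2.-integrable setT ((EFin \o W) \_ unit_square).
  exact: (integrable_mkcond _ measurable_unit_square).1 iW.
have := ae_integrable1 iW'; move: dW; apply: (@filterS2 _ _ (ae_filter_ringOfSetsType mu)) => x dx ix _.
rewrite /fubini_F /H /patch.
case: ifPn => [/set_mem Ix|nIx]; last first.
  rewrite integral0_eq// => y _; case: ifPn => // /set_mem [/= /mem_set].
  by rewrite (negbTE nIx).
have e y : ((x, y) \in @unit_square R) = (y \in @unit_interval R).
  by apply/idP/idP => [/set_mem[_ /mem_set]|/set_mem Iy] //; apply/mem_set.
under eq_integral do rewrite e.
have ix' : mu.-integrable unit_interval (fun y => (W (x, y))%:E).
  apply/(integrable_mkcond _ measurable_unit_interval).
  apply: eq_integrable ix => // y _.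
  by rewrite /patch e.
transitivity (\int[mu]_(y in unit_interval) ((g x)%:E * (W (x, y))%:E))%E.
  rewrite [RHS]integral_mkcond; apply: eq_integral => y _.
  by rewrite /patch; case: ifP => // _; rewrite -EFinM mulrC.
rewrite integralZl//.
(* The real-valued integral in the degree hypothesis would be 0 by default if the extended one were
   infinite; integrability of the section at almost every [x] excludes this. *)
suff -> : (\int[mu]_(y in unit_interval) (W (x, y))%:E = (d x)%:E)%E by [].
by rewrite -(dx Ix) fineK//; exact: integrable_fin_num.
Qed.

Lemma kernel_integral_fst W g : mu2.-integrable unit_square (EFin \o W) ->
  unit_degree W -> measurable_fun unit_interval g ->
  (forall x, unit_interval x -> `|g x| <= 1) ->
  (\int[mu2]_(z in unit_square) (W z * g z.1)%:E =
   \int[mu]_(x in unit_interval) (g x)%:E)%E.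
Proof.
move=> iW dW mg g1; rewrite (@kernel_integral_degree W (cst 1))//.
by apply: eq_integral => x _; rewrite mulr1.
Qed.

(** Almost everywhere symmetry of [W] reduces this to the first variable after exchanging the
    coordinates. *)
Lemma kernel_integral_snd W g : kernel2 W ->
  unit_degree W -> measurable_fun unit_interval g ->
  (forall x, unit_interval x -> `|g x| <= 1) ->
  (\int[mu2]_(z in unit_square) (W z * g z.2)%:E =
   \int[mu]_(x in unit_interval) (g x)%:E)%E.
Proof.
move=> [iW sW] dW mg g1.
have iWg1 : mu2.-integrable unit_square (fun z => (W z * g z.1)%:E).
  apply: (@integrable_kernelM W (fun z => g z.1) 1) => //; first exact: measurable_fun_fst.
  by move=> z [z1 _]; exact: g1.
have iWg2 : mu2.-integrable unit_square (fun z => (W z * g z.2)%:E).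
  apply: (@integrable_kernelM W (fun z => g z.2) 1) => //; first exact: measurable_fun_snd.
  by move=> z [_ z2]; exact: g1.
rewrite -(kernel_integral_fst iW)// [RHS]integral_mkcond -integral_swap; last first.
  exact: (integrable_mkcond _ measurable_unit_square).1 iWg1.
rewrite integral_mkcond; apply: ae_eq_integral => //.
- exact: measurable_int ((integrable_mkcond _ measurable_unit_square).1 iWg2).
- exact: measurable_int (integrable_swap ((integrable_mkcond _ measurable_unit_square).1 iWg1)).
move: sW; apply: (@filterS _ _ (ae_filter_ringOfSetsType mu2)) => -[x y] /= sxy _; rewrite /patch /=.
have -> : ((y, x) \in @unit_square R) = ((x, y) \in @unit_square R).
  by apply/idP/idP => /set_mem[? ?]; apply/mem_set.
by case: ifPn => // /set_mem /sxy ->.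
Qed.

End unit_square_integrals.

(** * Optimality of constant functions *)

(** The difference agrees almost everywhere with its positive part, whose integral is
    nonnegative. *)
Lemma le_Rintegral_ae d (T : measurableType d) (R : realType)
    (nu : {measure set T -> \bar R}) (D : set T) (f g : T -> R) :
  measurable D -> nu.-integrable D (EFin \o f) ->
  nu.-integrable D (EFin \o g) ->
  {ae nu, forall x, D x -> f x <= g x} ->
  \int[nu]_(x in D) f x <= \int[nu]_(x in D) g x.
Proof.
move=> mD intf intg fg; rewrite -subr_ge0 -RintegralB//.
have /measurable_EFinP mf := measurable_int _ intf.
have /measurable_EFinP mg := measurable_int _ intg.
have mgf : measurable_fun D (fun x => g x - f x) by exact: measurable_funB.
rewrite /Rintegral (@ae_eq_integral _ _ _ nu D
    (fun x => (Num.max (g x - f x) 0)%:E)) //.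
- by apply: Rintegral_ge0 => x _; rewrite le_max lexx orbT.
- exact/measurable_EFinP.
- by apply/measurable_EFinP; exact: measurable_maxr.
- apply: filterS fg => x fgx Dx; congr EFin.
  by apply/esym/max_idPl; rewrite subr_ge0 fgx.
Qed.

Section color_density.
Context {R : realType}.
Local Notation mu := (@lebesgue_measure R).
Local Notation mu2 := (lebesgue2 R).
Local Notation I := (@unit_interval R).
Implicit Types (W : R * R -> R) (f : 'I_2 -> R -> R).

Local Hint Resolve measurable_unit_interval measurable_unit_square : core.

Lemma measurable_F2 f r : F2 f -> measurable_fun I (f r).
Proof. by case. Qed.

Lemma F2_itv f r x : F2 f -> I x -> 0 <= f r x <= 1.
Proof. by case=> _ + _; exact. Qed.

Lemma F2_norm f r x : F2 f -> I x -> `|f r x| <= 1.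
Proof. by move=> Ff /(F2_itv r Ff)/andP[f0 f1]; rewrite ger0_norm. Qed.

Lemma G_le W f r : kernel2 W -> unit_degree W -> ae_positive W -> F2 f ->
  G W r f <= \int[mu]_(x in I) f r x ^+ 2.
Proof.
move=> kW dW pW Ff; have [iW _] := kW.
pose g x := f r x ^+ 2.
have mf := measurable_F2 r Ff.
have mg : measurable_fun I g by exact: measurable_funX.
have g1 x : I x -> `|g x| <= 1.
  by move=> Ix; rewrite normrX exprn_ile1// F2_norm.
have ig1 : mu2.-integrable unit_square (fun z => (W z * g z.1)%:E).
  apply: (@integrable_kernelM _ W (fun z => g z.1) 1) => //; first exact: measurable_fun_fst.
  by move=> z [z1 _]; exact: g1.
have ig2 : mu2.-integrable unit_square (fun z => (W z * g z.2)%:E).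
  apply: (@integrable_kernelM _ W (fun z => g z.2) 1) => //; first exact: measurable_fun_snd.
  by move=> z [_ z2]; exact: g1.
have iff : mu2.-integrable unit_square (fun z => (W z * f r z.1 * f r z.2)%:E).
  under eq_fun do rewrite -mulrA.
  apply: (@integrable_kernelM _ W (fun z => f r z.1 * f r z.2) 1) => //.
    by apply: measurable_funM; [exact: measurable_fun_fst|exact: measurable_fun_snd].
  by move=> z [z1 z2]; rewrite normrM mulr_ile1// F2_norm.
have e1 : \int[mu2]_(z in unit_square) (W z * g z.1) = \int[mu]_(x in I) g x.
  by congr fine; exact: kernel_integral_fst.
have e2 : \int[mu2]_(z in unit_square) (W z * g z.2) = \int[mu]_(x in I) g x.
  by congr fine; exact: kernel_integral_snd.
(* Unit degrees turn the single integral into an average of two integrals over the square. The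
   integrands then differ by half of [W z * (f r z.1 - f r z.2) ^+ 2]. *)
have -> : \int[mu]_(x in I) f r x ^+ 2 =
    \int[mu2]_(z in unit_square) (2^-1 * (W z * g z.1 + W z * g z.2)).
  rewrite RintegralZl//; last exact: (integrableD measurable_unit_square ig1 ig2).
  by rewrite RintegralD// e1 e2 /g; field.
apply: le_Rintegral_ae => //.
  exact: (integrableZl measurable_unit_square _ (integrableD measurable_unit_square ig1 ig2)).
move: pW; apply: (@filterS _ _ (ae_filter_ringOfSetsType mu2)) => z Wz Iz.
have := Wz Iz; rewrite /g => W0; rewrite -subr_ge0.
rewrite [X in 0 <= X](_ : _ = 2^-1 * (W z * (f r z.1 - f r z.2) ^+ 2)); last by field.
by rewrite mulr_ge0// mulr_ge0 ?sqr_ge0// ltW.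
Qed.

(** A kernel with unit degrees has total mass 1. *)
Lemma G_ae_cst W f r c : kernel2 W -> unit_degree W -> F2 f ->
  {ae mu, forall x, I x -> f r x = c} -> G W r f = c ^+ 2.
Proof.
move=> [iW sW] dW Ff fc.
have mf := measurable_F2 r Ff.
have iff : mu2.-integrable unit_square (fun z => (W z * f r z.1 * f r z.2)%:E).
  under eq_fun do rewrite -mulrA.
  apply: (@integrable_kernelM _ W (fun z => f r z.1 * f r z.2) 1) => //.
    by apply: measurable_funM; [exact: measurable_fun_fst|exact: measurable_fun_snd].
  by move=> z [z1 z2]; rewrite normrM mulr_ile1// F2_norm.
transitivity (\int[mu2]_(z in unit_square) (c ^+ 2 * W z)).
  congr fine; apply: ae_eq_integral => //.
  - exact: measurable_int iff.
  - have := integrableZl measurable_unit_square (c ^+ 2) iW.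
    exact: measurable_int.
  move: (ae_fst fc) (ae_snd fc).
  apply: (@filterS2 _ _ (ae_filter_ringOfSetsType mu2)) => z fz1 fz2 [z1 z2].
  by rewrite fz1// fz2//; congr EFin; ring.
rewrite RintegralZl// -[RHS]mulr1; congr (_ * _).
transitivity (\int[mu2]_(z in unit_square) (W z * 1)).
  by apply: eq_Rintegral => z _; rewrite mulr1.
transitivity (\int[mu]_(x in I) (1 : R)).
  by congr fine; apply: (@kernel_integral_fst _ W (cst 1)) => // x _; rewrite normr1.
by rewrite Rintegral_cst// mul1r [X in fine X]lebesgue_unit_interval.
Qed.

End color_density.

(** * From the free energy to the relative entropy *)

Section relative_entropy.
Context {R : realType}.
Local Notation mu := (@lebesgue_measure R).
Local Notation I := (@unit_interval R).
Implicit Types (p x c : R) (f : 'I_2 -> R -> R) (g : R -> R).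

Local Hint Resolve measurable_unit_interval measurable_unit_square : core.

(** From [ln x^-1 <= x^-1 - 1] follows [- (x * ln x) <= 1 - x]. The crude bound 1 suffices for
    integrability. *)
Lemma xln_norm_le x : 0 <= x <= 1 -> `|x * ln x| <= 1.
Proof.
move=> x01; rewrite ler0_norm ?xln_le0// lerNl.
case/andP: x01; rewrite le_eqVlt => /predU1P[<- _|x0 x1].
  by rewrite mul0r; lra.
have : ln x^-1 <= x^-1 - 1.
  rewrite [X in ln X](_ : _ = 1 + (x^-1 - 1)); last by ring.
  by apply: le_ln1Dx; rewrite ltrBrDr addNr invr_gt0.
rewrite lnV ?posrE// -(ler_pM2l x0) mulrBr mulfV ?gt_eqF//; lra.
Qed.

Lemma integrable_xln g : measurable_fun I g ->
  (forall x, I x -> 0 <= g x <= 1) ->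
  mu.-integrable I (fun x => (g x * ln (g x))%:E).
Proof.
move=> mg g01; apply: (@integrable_unit_interval _ _ 1).
  by apply: measurable_funM => //; apply: measurableT_comp => //; exact: measurable_ln.
by move=> x Ix; apply: xln_norm_le; exact: g01.
Qed.

Lemma Rintegral_unit_cst c : \int[mu]_(x in I) c = c.
Proof. by rewrite Rintegral_cst// [X in fine X]lebesgue_unit_interval mulr1. Qed.

Lemma F2_integrable f r : F2 f -> mu.-integrable I (EFin \o f r).
Proof.
move=> Ff; apply: (@integrable_unit_interval _ _ 1); first exact: measurable_F2.
by move=> x; exact: F2_norm.
Qed.

Lemma big_color (V : nmodType) (F : 'I_2 -> V) : \sum_(r < 2) F r = F 0 + F 1.
Proof.
by rewrite !big_ord_recl big_ord0 addr0; congr (_ + F _); exact: val_inj.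
Qed.

Lemma relative_entropyE p f : 0 < p < 1 -> F2 f ->
  relative_entropy p (f 0) =
  \int[mu]_(u in I) (\sum_(r < 2) f r u * ln (f r u))
  - (ln p * \int[mu]_(u in I) f 0 u + ln (1 - p) * \int[mu]_(u in I) f 1 u).
Proof.
move=> p01 Ff.
have i0 := F2_integrable 0 Ff; have i1 := F2_integrable 1 Ff.
have il r : mu.-integrable I (fun x => (f r x * ln (f r x))%:E).
  by apply: integrable_xln; [exact: measurable_F2|move=> x; exact: F2_itv].
have iL : mu.-integrable I (EFin \o (fun u => \sum_(r < 2) f r u * ln (f r u))).
  under eq_fun do rewrite big_color.
  exact: (integrableD measurable_unit_interval (il 0) (il 1)).
have iZ0 : mu.-integrable I (EFin \o (fun u => ln p * f 0 u)).
  exact: (integrableZl measurable_unit_interval (ln p) i0).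
have iZ1 : mu.-integrable I (EFin \o (fun u => ln (1 - p) * f 1 u)).
  exact: (integrableZl measurable_unit_interval (ln (1 - p)) i1).
rewrite -!RintegralZl// -RintegralD// -RintegralB//; last first.
  exact: (integrableD measurable_unit_interval iZ0 iZ1).
apply: eq_Rintegral => x /set_mem Ix; rewrite big_color.
have [_ _ /(_ x Ix) fx] := Ff.
have -> : 1 - f 0 x = f 1 x by rewrite -fx addrC addKr.
have := F2_itv 0 Ff Ix; have := F2_itv 1 Ff Ix => /andP[f1 _] /andP[f0 _].
by rewrite !xln_div//; [ring|lra|lra].
Qed.

(** Here [h r = ln (mu0 r) + ln Z], and the two colour densities have total integral 1, so the terms
    in [ln Z] cancel. *)
Lemma free_energyE p (mu0 h : 'I_2 -> R) f : 0 < p < 1 ->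
  mu0 0 = p -> mu0 1 = 1 - p ->
  (forall r, mu0 r = expR (h r) / (expR (h 0) + expR (h 1))) -> F2 f ->
  free_energy h f + ln (expR (h 0) + expR (h 1)) = relative_entropy p (f 0).
Proof.
move=> p01 m0 m1 hmu Ff; rewrite relative_entropyE// /free_energy big_color.
set Z := expR (h 0) + expR (h 1).
have Z0 : 0 < Z by rewrite addr_gt0// expR_gt0.
have lnmu r : h r = ln (mu0 r) + ln Z.
  by rewrite hmu ln_div ?posrE ?expR_gt0// expRK subrK.
have sum1 : \int[mu]_(u in I) f 0 u + \int[mu]_(u in I) f 1 u = 1.
  rewrite -RintegralD//; [|exact: F2_integrable..].
  rewrite -[RHS](Rintegral_unit_cst 1); apply: eq_Rintegral => x /set_mem Ix.
  by have [_ _ ->] := Ff.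
rewrite !lnmu m0 m1.
have -> : \int[mu]_(u in I) f 1 u = 1 - \int[mu]_(u in I) f 0 u.
  by rewrite -sum1 addrC addKr.
ring.
Qed.

(** The tangent inequality is integrated at [x = f 0 u]. Only the second moment of [f 0] survives,
    which [G_le] bounds from below. *)
Lemma relative_entropy_ge p c lambda f : 0 < p < 1 -> F2 f ->
  (forall x, 0 <= x <= 1 ->
    bernoulli_divergence p c + lambda * (x ^+ 2 - c ^+ 2)
      <= bernoulli_divergence p x) ->
  bernoulli_divergence p c + lambda * (\int[mu]_(x in I) f 0 x ^+ 2 - c ^+ 2)
    <= relative_entropy p (f 0).
Proof.
move=> p01 Ff tangent.
have i0 := F2_integrable 0 Ff; have i1 := F2_integrable 1 Ff.
have il r : mu.-integrable I (fun x => (f r x * ln (f r x))%:E).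
  by apply: integrable_xln; [exact: measurable_F2|move=> x; exact: F2_itv].
have isq : mu.-integrable I (EFin \o (fun x => f 0 x ^+ 2)).
  apply: (@integrable_unit_interval _ _ 1).
    by apply: measurable_funX; exact: measurable_F2.
  by move=> x Ix; rewrite normrX exprn_ile1// F2_norm.
have ic k : mu.-integrable I (EFin \o (fun=> k : R)).
  by apply: (@integrable_unit_interval _ _ `|k|).
have -> : bernoulli_divergence p c
    + lambda * (\int[mu]_(x in I) f 0 x ^+ 2 - c ^+ 2) =
  \int[mu]_(x in I)
    (bernoulli_divergence p c - lambda * c ^+ 2 + lambda * f 0 x ^+ 2).
  rewrite RintegralD//; last exact: (integrableZl measurable_unit_interval lambda isq).
  by rewrite RintegralZl// Rintegral_unit_cst; ring.
apply: le_Rintegral => //.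
- exact: (integrableD measurable_unit_interval
    (ic (bernoulli_divergence p c - lambda * c ^+ 2))
    (integrableZl measurable_unit_interval lambda isq)).
(* Splitting the logarithms of quotients leaves terms [x * ln x] and linear terms, all bounded. *)
- apply: (@eq_integrable _ _ _ mu _ measurable_unit_interval
    (EFin \o (fun x => f 0 x * ln (f 0 x) + f 1 x * ln (f 1 x)
      + (- ln p * f 0 x + - ln (1 - p) * f 1 x)))).
    move=> x /set_mem Ix; congr EFin.
    have [_ _ /(_ x Ix) fx] := Ff.
    have -> : 1 - f 0 x = f 1 x by rewrite -fx addrC addKr.
    have := F2_itv 0 Ff Ix; have := F2_itv 1 Ff Ix => /andP[f1 _] /andP[f0 _].
    by rewrite !xln_div//; [ring|lra|lra].
  exact: (integrableD measurable_unit_interval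
    (integrableD measurable_unit_interval (il 0) (il 1))
    (integrableD measurable_unit_interval
      (integrableZl measurable_unit_interval (- ln p) i0)
      (integrableZl measurable_unit_interval (- ln (1 - p)) i1))).
- move=> x Ix; apply: le_trans (tangent (f 0 x) (F2_itv 0 Ff Ix)); lra.
Qed.

Lemma F2_two_coloring g : measurable_fun I g ->
  (forall x, I x -> 0 <= g x <= 1) -> F2 (two_coloring g).
Proof.
move=> mg g01; split=> [r|r x Ix|x Ix]; rewrite /two_coloring /=.
- by case: (r == 0); [exact: mg|exact: measurable_funB].
- by case: (r == 0); have := g01 x Ix; lra.
- by rewrite addrC subrK.
Qed.

Lemma rate_function_constant W p (mu0 h : 'I_2 -> R) y :
  kernel2 W -> unit_degree W -> ae_positive W -> 0 < p < 1 ->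
  mu0 0 = p -> mu0 1 = 1 - p ->
  (forall r, mu0 r = expR (h r) / (expR (h 0) + expR (h 1))) ->
  p ^+ 2 <= y < 1 ->
  (1 + expR 2)^-1 <= p \/
    (exists2 eta, eta_equation p eta &
      Num.sqrt y < 1 - eta \/ eta < Num.sqrt y) ->
  rate_function W h (1, 0) y = (constant_rate p y)%:E.
Proof.
move=> kW dW pW p01 m0 m1 hmu /andP[py y1] Hp.
have p0 : 0 < p by lra.
have y0 : 0 <= y by rewrite (le_trans _ py)// sqr_ge0.
set a := Num.sqrt y in Hp *.
have aE : a ^+ 2 = y by rewrite sqr_sqrtr.
have pa : p <= a < 1.
  rewrite -[leLHS](ger0_norm (ltW p0)) -sqrtr_sqr ler_wsqrtr//=.
  by rewrite -sqrtr1 ltr_sqrt.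
have [lambda l0 tangent] := divergence_tangent p01 pa Hp.
have a01 : 0 <= a <= 1 by lra.
pose f := two_coloring (cst a : R -> R).
have Ff : F2 f by apply: F2_two_coloring => // x _; exact: a01.
have Gf : G W 0 f = y.
  rewrite (@G_ae_cst _ W f 0 a)//.
  by apply: (@filterE _ _ (ae_filter_ringOfSetsType mu)).
have Rf : relative_entropy p (f 0) = constant_rate p y.
  exact: (Rintegral_unit_cst (constant_rate p y)).
rewrite /rate_function -[in RHS]Rf -(@free_energyE p mu0 h f)// EFinD.
congr (_ + _)%E; apply/eqP; rewrite eq_le; apply/andP; split.
  (* The constant [a] is feasible, which bounds the infimum from above; the remaining inequality
     says that every competitor [g] costs at least as much. *)
  by apply: ereal_inf_lbound; exists f => //; split=> //=; rewrite Gf mul1r mul0r addr0.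
apply: le_ereal_inf_tmp => _ [g [Fg /= Gg] <-]; rewrite lee_fin.
rewrite mul1r mul0r addr0 in Gg.
rewrite -(lerD2r (ln (expR (h 0) + expR (h 1)))).
rewrite !(@free_energyE p mu0 h)// Rf.
apply: le_trans (relative_entropy_ge p01 Fg tangent).
(* The constraint gives [y = G W 0 g], at most the integral of [g 0 x ^+ 2], and [lambda >= 0]. *)
rewrite aE lerDl mulr_ge0// subr_ge0 -Gg; exact: G_le.
Qed.

End relative_entropy.

(** * A kernel without constant optimizers *)

Section nonconstant_optimizers.
Context {R : realType}.
Local Notation mu := (@lebesgue_measure R).
Local Notation mu2 := (lebesgue2 R).
Local Notation I := (@unit_interval R).
Implicit Types (p x y c eta kappa delta : R) (g : R -> R).

Local Hint Resolve measurable_unit_interval measurable_unit_square : core.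

(** The squares of [eta] and [1 - eta] average to [4^-1 + d2], where [d2 = (eta - 2^-1) ^+ 2]. The
    gap is therefore a drop of [tilted L L] minus the loss [L * d2 * (1 - kappa)], which is small
    for [kappa] near 1. *)
Lemma divergence_gap p eta : 0 < p < 1 -> eta_equation p eta ->
  2 < - logit p ->
  exists2 kappa, 0 < kappa < 1 &
    (bernoulli_divergence p eta + bernoulli_divergence p (1 - eta)) / 2 <
    bernoulli_divergence p (Num.sqrt (4^-1 + kappa * (eta - 2^-1) ^+ 2)).
Proof.
move=> p01 /eta_equationE -/(_ p01)[eta_itv Leta] L2.
set L := - logit p in Leta L2.
set d2 := (eta - 2^-1) ^+ 2.
have d0 : 0 < d2 by rewrite exprn_gt0//; lra.
have half_sqrt k : 0 < k <= 1 -> 2^-1 < Num.sqrt (4^-1 + k * d2) < eta.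
  move=> k01; have kd0 : 0 < k * d2 by rewrite mulr_gt0//; lra.
  have root b : 0 <= b -> b = Num.sqrt (b ^+ 2).
    by move=> b0; rewrite sqrtr_sqr ger0_norm.
  apply/andP; split.
    rewrite [ltLHS]root// ltr_sqrt; last lra.
    by rewrite [ltLHS](_ : _ = 4^-1); [rewrite ltrDl|field].
  rewrite [ltRHS]root; last lra.
  rewrite ltr_sqrt; last by rewrite exprn_gt0//; lra.
  apply: (@le_lt_trans _ _ (4^-1 + d2)); first by rewrite lerD2l ler_piMl//; lra.
  by rewrite /d2; nra.
(* The limiting point [kappa = 1] is still strictly below [eta], so [D] is a positive lower bound
   for the drop, uniform in [kappa]. *)
pose top := Num.sqrt (4^-1 + 1 * d2).
have top_itv : 2^-1 < top < eta by apply: half_sqrt; lra.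
pose D := tilted L L top - tilted L L eta.
have D0 : 0 < D by rewrite subr_gt0 (tilted_decr eta_itv)//; lra.
have Ld0 : 0 < L * d2 by rewrite mulr_gt0//; lra.
have S0 : 0 < D + L * d2 by rewrite addr_gt0.
(* With this choice the loss [L * d2 * (1 - kappa)] equals [D * kappa], which is less than [D]. *)
pose kappa := L * d2 / (D + L * d2).
have k01 : 0 < kappa < 1.
  by rewrite divr_gt0//= ltr_pdivrMr// mul1r; lra.
exists kappa => //.
have x_itv : 2^-1 < Num.sqrt (4^-1 + kappa * d2) < eta by apply: half_sqrt; lra.
rewrite !(bernoulli_divergenceE L p01); [|lra..].
rewrite -/L tiltedC sqr_sqrtr; last by rewrite addr_ge0// mulr_ge0; lra.
have top_le : tilted L L top <= tilted L L (Num.sqrt (4^-1 + kappa * d2)).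
  apply/ltW/(tilted_decr eta_itv Leta); [lra| |lra].
  rewrite ltr_sqrt; last by rewrite addr_gt0 ?mul1r.
  by rewrite ltrD2l ltr_pM2r//; lra.
have gap : L * d2 * (1 - kappa) < D.
  have -> : L * d2 * (1 - kappa) = D * kappa.
    by rewrite /kappa; field; rewrite gt_eqF.
  by rewrite gtr_pMr//; lra.
by move: gap top_le; rewrite /D /d2; lra.
Qed.

(** * The two-block kernel and its two-valued competitor *)

Definition half_sign x : R := 2 * \1_(`]-oo, 2^-1[%classic) x - 1.

Lemma half_signP x : half_sign x = 1 \/ half_sign x = -1.
Proof.
rewrite /half_sign indicE; case: (_ \in _) => /=; [left|right]; ring.
Qed.

Lemma half_sign_sqr x : half_sign x ^+ 2 = 1.
Proof. by case: (half_signP x) => ->; rewrite ?sqrrN expr1n. Qed.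

Lemma measurable_half_sign : measurable_fun I half_sign.
Proof. by apply: measurable_funB => //; exact: measurable_funM. Qed.

(** The two halves of the interval have equal length, so the sign integrates to 0. All the integrals
    below are put in this affine form. *)
Lemma Rintegral_half_sign c c' : \int[mu]_(x in I) (c + c' * half_sign x) = c.
Proof.
pose A := (`]-oo, 2^-1[%classic : set (measurableTypeR R)).
have mA : measurable A by exact: measurable_itv.
have iA : mu.-integrable I (EFin \o (\1_A : R -> R)).
  apply: (@integrable_unit_interval _ _ 1); first exact: measurable_indic.
  by move=> x _; rewrite indicE; case: (_ \in _); rewrite ?normr1 ?normr0.
have -> : \int[mu]_(x in I) (c + c' * half_sign x) =
    \int[mu]_(x in I) (c - c' + 2 * c' * \1_A x).
  by apply: eq_Rintegral => x _; rewrite /half_sign /A; ring.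
have ic : mu.-integrable I (EFin \o (fun=> c - c')).
  by apply: (@integrable_unit_interval _ _ `|c - c'|).
rewrite RintegralD//; last exact: (integrableZl measurable_unit_interval (2 * c') iA).
rewrite RintegralZl// Rintegral_unit_cst.
have -> : \int[mu]_(x in I) \1_A x = 2^-1.
  rewrite /Rintegral integral_indic//.
  have -> : A `&` I = `[0, 2^-1[%classic.
    apply/seteqP; split=> x /=; rewrite /unit_interval /= !in_itv/=.
      by move=> [h1 /andP[h2 h3]]; rewrite h2.
    by move=> /andP[h1 h2]; split=> //; lra.
  have e : mu (`[0, 2^-1[%classic : set R) = (2^-1)%:E.
    by rewrite lebesgue_measure_itv/= lte_fin invr_gt0 ltr0n oppr0 adde0.
  by rewrite [X in fine X]e.
by field.
Qed.

(** The value is [1 + kappa] on the two diagonal blocks and [1 - kappa] on the other two. *)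
Definition block_kernel kappa (z : R * R) : R :=
  1 + kappa * (half_sign z.1 * half_sign z.2).

Lemma block_kernel_bounds kappa z : 0 < kappa < 1 ->
  0 < block_kernel kappa z <= 2.
Proof.
rewrite /block_kernel => k01.
by case: (half_signP z.1) => ->; case: (half_signP z.2) => ->; lra.
Qed.

Lemma measurable_block_kernel kappa :
  measurable_fun unit_square (block_kernel kappa).
Proof.
apply: measurable_funD => //; apply: measurable_funM => //.
have mh := measurable_half_sign.
by apply: measurable_funM; [exact: measurable_fun_fst|exact: measurable_fun_snd].
Qed.

Lemma kernel2_block kappa : 0 < kappa < 1 -> kernel2 (block_kernel kappa).
Proof.
move=> k01; split.
  apply: (@integrable_unit_square _ _ 2); first exact: measurable_block_kernel.
  by move=> z _; have := block_kernel_bounds z k01 => /andP[w0 w2]; rewrite gtr0_norm.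
apply: (@filterE _ _ (ae_filter_ringOfSetsType mu2)) => z _.
by rewrite /block_kernel/= [half_sign z.2 * _]mulrC.
Qed.

Lemma ae_positive_block kappa : 0 < kappa < 1 -> ae_positive (block_kernel kappa).
Proof.
move=> k01; apply: (@filterE _ _ (ae_filter_ringOfSetsType mu2)) => z _.
by have /andP[] := block_kernel_bounds z k01.
Qed.

Lemma unit_degree_block kappa : unit_degree (block_kernel kappa).
Proof.
apply: (@filterE _ _ (ae_filter_ringOfSetsType mu)) => x _.
rewrite -[RHS](Rintegral_half_sign 1 (kappa * half_sign x)).
by apply: eq_Rintegral => y _; rewrite /block_kernel/= mulrA.
Qed.

Definition step_density delta x : R := 2^-1 + delta * half_sign x.

Lemma step_density_itv delta x : 0 < delta < 2^-1 -> 0 <= step_density delta x <= 1.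
Proof. by rewrite /step_density; case: (half_signP x) => ->; lra. Qed.

Lemma measurable_step_density delta : measurable_fun I (step_density delta).
Proof.
apply: measurable_funD => //; apply: measurable_funM => //.
exact: measurable_half_sign.
Qed.

Lemma F2_step delta : 0 < delta < 2^-1 -> F2 (two_coloring (step_density delta)).
Proof.
move=> d01; apply: F2_two_coloring; first exact: measurable_step_density.
by move=> x _; exact: step_density_itv.
Qed.

Lemma G_block_step kappa delta : 0 < kappa < 1 -> 0 < delta < 2^-1 ->
  G (block_kernel kappa) 0 (two_coloring (step_density delta)) =
  4^-1 + kappa * delta ^+ 2.
Proof.
move=> k01 d01; pose g := step_density delta.
have mg : measurable_fun I g by exact: measurable_step_density.
have g1 x : `|g x| <= 1.
  by have /andP[g0 g1] := step_density_itv x d01; rewrite ger0_norm.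
have [iW _] := kernel2_block k01.
(* [d x] is the inner integral over the second variable, that is, the degree at [x] of the kernel
   weighted by [g z.2]. *)
pose d x := 2^-1 + kappa * delta * half_sign x.
have md : measurable_fun I d.
  apply: measurable_funD => //; apply: measurable_funM => //.
  exact: measurable_half_sign.
transitivity (\int[mu]_(x in I) (g x * d x)); last first.
  rewrite -[RHS](Rintegral_half_sign _ (2^-1 * (delta + kappa * delta))).
  apply: eq_Rintegral => x _; rewrite /g /d /step_density.
  have := half_sign_sqr x; set s := half_sign x => s2.
  (* A factor [s ^+ 2 = 1] is inserted so that the goal becomes a polynomial identity in [s]. *)
  have -> : kappa * delta ^+ 2 = kappa * delta ^+ 2 * s ^+ 2 by rewrite s2 mulr1.
  by field.
have iWg : mu2.-integrable unit_square
    (EFin \o (fun z => block_kernel kappa z * g z.2)).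
  apply: (@integrable_kernelM _ _ (fun z => g z.2) 1) => //; exact: measurable_fun_snd.
have dE x : \int[mu]_(y in I) (block_kernel kappa (x, y) * g y) = d x.
  rewrite -[RHS](Rintegral_half_sign _ (delta + 2^-1 * kappa * half_sign x)).
  apply: eq_Rintegral => y _; rewrite /d /block_kernel /g /step_density/=.
  have := half_sign_sqr y; set t := half_sign y; set s := half_sign x => t2.
  have -> : kappa * delta * s = kappa * delta * s * t ^+ 2 by rewrite t2 mulr1.
  ring.
have dWg : {ae mu, forall x, unit_interval x ->
    \int[mu]_(y in I) (block_kernel kappa (x, y) * g y) = d x}.
  by apply: (@filterE _ _ (ae_filter_ringOfSetsType mu)) => ? _; exact: dE.
transitivity (\int[mu2]_(z in unit_square) (block_kernel kappa z * g z.2 * g z.1)).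
  apply: eq_Rintegral => z _; rewrite /two_coloring /= -/g; ring.
congr fine.
by apply: (@kernel_integral_degree _ (fun z => block_kernel kappa z * g z.2) d g).
Qed.

(** Any function of a sign is affine in it, with the half-sum and half-difference of its two values
    as coefficients; only the half-sum survives integration. *)
Lemma relative_entropy_step p delta :
  relative_entropy p (step_density delta) =
  (bernoulli_divergence p (2^-1 + delta)
   + bernoulli_divergence p (1 - (2^-1 + delta))) / 2.
Proof.
set B1 := bernoulli_divergence _ _; set B2 := bernoulli_divergence _ _.
rewrite -[RHS](Rintegral_half_sign _ ((B1 - B2) / 2)).
apply: eq_Rintegral => x _.
rewrite -/(bernoulli_divergence p (step_density delta x)) /step_density.
case: (half_signP x) => ->.
  by rewrite !mulr1 -/B1; field.
have -> : 2^-1 + delta * -1 = 1 - (2^-1 + delta) by field.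
by rewrite -/B2; field.
Qed.

Lemma Rintegral_ae_cst g c : measurable_fun I g ->
  {ae mu, forall x, I x -> g x = c} -> \int[mu]_(x in I) g x = c.
Proof.
move=> mg gc; rewrite -[RHS](Rintegral_unit_cst c); congr fine.
apply: ae_eq_integral => //; first exact/measurable_EFinP.
move: gc; apply: (@filterS _ _ (ae_filter_ringOfSetsType mu)) => x gx Ix.
by rewrite gx.
Qed.

(** A constant optimizer would satisfy [c ^+ 2 = y], hence be the square root of [y], but the
    feasible step density has strictly smaller relative entropy. *)
Lemma block_optimizer_nonconstant p eta kappa : 2^-1 < eta < 1 -> 0 < kappa < 1 ->
  let y := 4^-1 + kappa * (eta - 2^-1) ^+ 2 in
  (bernoulli_divergence p eta + bernoulli_divergence p (1 - eta)) / 2 <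
    bernoulli_divergence p (Num.sqrt y) ->
  forall f, optimizer (block_kernel kappa) p y f -> nonconstant f.
Proof.
move=> eta_itv k01 y gap f [[Ff Gf] fmin] [c fc].
have mf : measurable_fun I f := measurable_F2 0 Ff.
(* The constraint fixes only [c ^+ 2]. The sign of [c] is read off the integral, since [f = c] holds
   only almost everywhere. *)
have c0 : 0 <= c.
  rewrite -(Rintegral_ae_cst mf fc); apply: Rintegral_ge0 => x Ix.
  by have /andP[] := F2_itv 0 Ff Ix.
have yc : y = c ^+ 2.
  rewrite -Gf; apply: G_ae_cst => //; first exact: kernel2_block.
  exact: unit_degree_block.
have d01 : 0 < eta - 2^-1 < 2^-1 by lra.
have := fmin (step_density (eta - 2^-1)).
rewrite relative_entropy_step [2^-1 + _]addrC subrK => le_step.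
have {le_step} := le_step (conj (F2_step d01) (G_block_step k01 d01)).
have -> : relative_entropy p f = bernoulli_divergence p c.
  apply: Rintegral_ae_cst.
    apply: measurable_funD; apply: measurable_funM => //.
    - apply: measurableT_comp; first exact: measurable_ln.
      exact: measurable_funM.
    - exact: measurable_funB.
    - apply: measurableT_comp; first exact: measurable_ln.
      by apply: measurable_funM => //; exact: measurable_funB.
  move: fc; apply: (@filterS _ _ (ae_filter_ringOfSetsType mu)) => x fx Ix.
  by rewrite fx.
by move: gap; rewrite yc sqrtr_sqr ger0_norm// => /lt_le_trans h /h; rewrite ltxx.
Qed.

End nonconstant_optimizers.

Theorem proposition2p15 (R : realType) (Winf : R * R -> R)
    (mu h : 'I_2 -> R) (p : R) (alpha : R * R)
    (Winf_kernel : kernel2 Winf)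
    (Winf_degree : unit_degree Winf)
    (Winf_positive : ae_positive Winf)
    (p01 : 0 < p < 1)
    (mu1 : mu 0 = p) (mu2 : mu 1 = 1 - p)
    (hmu : forall r, mu r = expR (h r) / (expR (h 0) + expR (h 1)))
    (alpha1_ge0 : 0 <= alpha.1) (alpha2_eq0 : alpha.2 = 0) :
  ((1 + expR 2)^-1 <= p ->
    forall y, p ^+ 2 <= y < 1 ->
      rate_function Winf h (1, 0) y = (constant_rate p y)%:E) /\
  (p < (1 + expR 2)^-1 ->
    (exists! eta, eta_equation p eta) /\
    forall eta, eta_equation p eta ->
      (forall y, p ^+ 2 <= y < (1 - eta) ^+ 2 \/ eta ^+ 2 < y < 1 ->
        rate_function Winf h (1, 0) y = (constant_rate p y)%:E) /\
      (exists (yinf : R) (W : R * R -> R),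
        [/\ (1 - eta) ^+ 2 <= yinf <= eta ^+ 2,
            kernel2 W,
            ae_positive W,
            unit_degree W
          & forall f, optimizer W p yinf f -> nonconstant f])).
Proof.
have rate y := rate_function_constant Winf_kernel Winf_degree Winf_positive
  p01 mu1 mu2 hmu (y := y).
split=> [p_large y py|p_small]; first by apply: rate => //; left.
split; first exact: eta_exists_unique.
move=> eta eta_eqn; have [eta_itv Leta] := (eta_equationE eta p01).1 eta_eqn.
split=> [y y_itv|].
  have p2_ge0 := sqr_ge0 p.
  have y_ge0 : 0 <= y by case: y_itv; have := sqr_ge0 eta; lra.
  have sqrt_y : Num.sqrt y < 1 - eta \/ eta < Num.sqrt y.
    have yE := sqr_sqrtr y_ge0; have sy0 := sqrtr_ge0 y.
    case: y_itv => /andP[y1 y2]; [left|right].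
      by rewrite -(ltr_pXn2r (ltn0Sn 1)) ?nnegrE ?yE//; lra.
    by rewrite -(ltr_pXn2r (ltn0Sn 1)) ?nnegrE ?yE//; lra.
  apply: rate; last by right; exists eta.
  case: y_itv => [/andP[-> y2]|/andP[y1 ->]]; first by nra.
  rewrite andbT.
  (* On the upper range, [p ^+ 2 <= y] follows from [p < 2^-1 < eta]. *)
  have e1 : 1 < expR 2 :> R by rewrite expR_gt1.
  have p_half : p < 2^-1.
    by apply: (lt_trans p_small); rewrite ltf_pV2 ?posrE//; lra.
  by apply: (le_trans _ (ltW y1)); rewrite ler_pXn2r ?nnegrE//; lra.
have L_gt2 : 2 < - logit p by rewrite ltNge -le_logit_threshold// -ltNge.
have [kappa kappa01 gap] := divergence_gap p01 eta_eqn L_gt2.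
exists (4^-1 + kappa * (eta - 2^-1) ^+ 2), (block_kernel kappa); split.
(* With [delta = eta - 2^-1] the bounds are [4^-1 - delta + delta ^+ 2] and
   [4^-1 + delta + delta ^+ 2], on either side of [4^-1 + kappa * delta ^+ 2]. *)
- have q0 := sqr_ge0 (eta - 2^-1).
  have : kappa * (eta - 2^-1) ^+ 2 <= (eta - 2^-1) ^+ 2 by rewrite ler_piMl//; lra.
  have : 0 <= kappa * (eta - 2^-1) ^+ 2 by rewrite mulr_ge0//; lra.
  by move=> ? ?; apply/andP; split; nra.
- exact: kernel2_block.
- exact: ae_positive_block.
- exact: unit_degree_block.
- exact: block_optimizer_nonconstant gap.
Qed.
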